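(* Let $A$ be a subgroup of a group $G$ and let $W$ be a subgroup of a finitely generated group $F$ whose commutator subgroup $F'$ has infinite index in $F$. Then the number of homomorphisms $\varphi: F\to G$ such that $\varphi(W)=A$ is divisible by $|A'|$, the order of the commutator subgroup of $A$.
   Context: Groups need not be finite; divisibility is understood in the sense of cardinal arithmetic: an infinite cardinal is divisible by every nonzero cardinal not exceeding it. *)

(* Defs.v *)
From HB Require Import structures.
From mathcomp Require Import all_boot.
Set Implicit Arguments. Unset Strict Implicit. Unset Printing Implicit Defensive.
Local Open Scope group_scope.

Section GroupDefs.
Variable G : groupType.

Definition is_subgroup (H : G -> Prop) : Prop :=
  [/\ H 1, (forall x y, H x -> H y -> H (x * y)) & (forall x, H x -> H x^-1)].

Definition generated (S : G -> Prop) : G -> Prop :=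
  fun x => forall H, is_subgroup H -> (forall s, S s -> H s) -> H x.

Definition derived (H : G -> Prop) : G -> Prop :=
  generated (fun z => exists x y, [/\ H x, H y & z = [~ x, y]]).

Definition setG : G -> Prop := fun _ => True.

Definition finitely_generated : Prop :=
  exists s : seq G, forall x, generated (fun y => y \in s) x.

Definition finite_index (H : G -> Prop) : Prop :=
  exists s : seq G, forall x, exists2 y, y \in s & H (y^-1 * x).

End GroupDefs.

Definition is_hom (F G : groupType) (f : F -> G) : Prop :=
  forall x y, f (x * y) = f x * f y.

Definition image_is (F G : groupType) (f : F -> G) (W : F -> Prop) (A : G -> Prop)
  : Prop := forall a, A a <-> exists2 w, W w & f w = a.

(* Cardinal divisibility: |{y | Q y}| = |{x | P x}| * |M| for some M, i.e.
   there is a bijection between {x | P x} x M and {y | Q y}.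
   (This agrees with: infinite cardinals are divisible by every nonzero
   cardinal not exceeding them, and finite ones in the usual sense.) *)
Definition card_dvd (T U : Type) (P : T -> Prop) (Q : U -> Prop) : Prop :=
  exists (M : Type) (h : T -> M -> U),
    [/\ (forall x m, P x -> Q (h x m)),
        (forall y, Q y -> exists x m, P x /\ h x m = y) &
        (forall x x' m m', P x -> P x' -> h x m = h x' m' -> x = x' /\ m = m')].

(* Main.v *)
(** Since [F] is finitely generated and [F'] has infinite index, [F] has an
    epimorphism [deg] onto the integers. For a subgroup [H] of [G], here
    [H = A'], and a homomorphism [phi], let [core phi] consist of the [c] in [H]
    that centralise [phi (ker deg)] and whose conjugates by [phi F] stay in [H].
    Multiplying the value of [phi] at an element [t] of degree 1 by [c] in
    [core phi] gives again a homomorphism; this partitions the homomorphisms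
    into blocks, the block of [phi] being in bijection with [core phi]. Now [H]
    permutes the blocks by conjugation, and the stabiliser of the block of [phi]
    is exactly [core phi], so the union of the [H]-orbit of that block has
    [|H : core phi| * |core phi| = |H|] elements. This works for infinite [H] as
    well, a bijection with [H] being obtained from coset representatives of
    [core phi]. The homomorphisms with [phi W = A] are closed under
    both operations because elements of [A'] are images of elements of [W'],
    which have degree 0. *)
Require Import Defs.
From HB Require Import structures.
From Stdlib Require Import Classical ClassicalEpsilon FunctionalExtensionality PropExtensionality.
From mathcomp Require Import all_boot all_order all_algebra.
From mathcomp Require Import ring.
Import GRing.Theory.
Local Open Scope group_scope.

(** * Integer powers in a group *)

Section IntegerPowers.
Set Implicit Arguments. Unset Strict Implicit.
Variable G : groupType.
Implicit Types (x y : G) (n : int).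

Definition expgz x n : G :=
  match n with Posz k => x ^+ k | Negz k => x ^- k.+1 end.

Lemma expgz0 x : expgz x 0%R = 1. Proof. by []. Qed.

Lemma expgz1 x : expgz x 1%R = x. Proof. by []. Qed.

Lemma expgz_succ x n : expgz x (n + 1)%R = expgz x n * x.
Proof.
case: n => [k|[|k]].
- by rewrite -PoszD addn1 /= expgSr.
- by rewrite /= expg1 mulVg.
rewrite (_ : (Negz k.+1 + 1)%R = Negz k); last by rewrite !NegzE -addn1 PoszD; ring.
by rewrite /= (expgS x k.+1) invgM mulgVK.
Qed.

Lemma expgz_pred x n : expgz x (n - 1)%R = expgz x n * x^-1.
Proof. by rewrite -{2}[n](subrK 1%R) expgz_succ mulgK. Qed.

Lemma expgz_unique (u : int -> G) :
  (forall m n, u (m + n)%R = u m * u n) -> forall n, u n = expgz (u 1%R) n.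
Proof.
move=> uD.
have u0 : u 0%R = 1 by apply: (mulgI (u 0%R)); rewrite -uD addr0 mulg1.
have uN n : u (- n)%R = (u n)^-1.
  by apply: (mulgI (u n)); rewrite -uD subrr u0 mulgV.
elim=> [|n IH|n IH]; first by rewrite u0.
  by rewrite -addn1 PoszD uD expgz_succ IH.
by rewrite -addn1 PoszD opprD uD expgz_pred IH (uN 1%R).
Qed.

Lemma expgzD x m n : expgz x (m + n)%R = expgz x m * expgz x n.
Proof.
elim: n => [|n IH|n IH]; first by rewrite addr0 mulg1.
  by rewrite -addn1 PoszD addrA !expgz_succ IH mulgA.
by rewrite -addn1 PoszD opprD addrA !expgz_pred IH mulgA.
Qed.

Lemma expgzN x n : expgz x (- n)%R = (expgz x n)^-1.
Proof. by apply: (mulgI (expgz x n)); rewrite -expgzD subrr mulgV. Qed.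

Lemma expgzM x m n : expgz x (m * n)%R = expgz (expgz x m) n.
Proof.
rewrite (expgz_unique (u := fun n => expgz x (m * n)%R)) ?mulr1 // => i j.
by rewrite mulrDr expgzD.
Qed.

Lemma subgroup_expgz (H : G -> Prop) x n : is_subgroup H -> H x -> H (expgz x n).
Proof.
move=> [H1 HM HV] Hx; elim: n => [|n IH|n IH] //.
  by rewrite -addn1 PoszD expgz_succ; apply: HM.
by rewrite -addn1 PoszD opprD expgz_pred; apply: HM => //; apply: HV.
Qed.

End IntegerPowers.

(** * Commutator subgroups *)

Section DerivedSubgroup.
Set Implicit Arguments. Unset Strict Implicit.
Variable G : groupType.
Implicit Types (H N : G -> Prop) (x y : G).

Lemma generated_subgroup (S : G -> Prop) : is_subgroup (generated S).
Proof.
split=> [H [] //|x y Sx Sy H sgH SH|x Sx H sgH SH].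
  by case: (sgH) => _ HM _; apply: HM; [apply: Sx | apply: Sy].
by case: (sgH) => _ _; apply; apply: Sx.
Qed.

Lemma derived_subgroup H : is_subgroup (derived H).
Proof. exact: generated_subgroup. Qed.

Lemma derivedR H x y : H x -> H y -> derived H [~ x, y].
Proof. by move=> Hx Hy N _; apply; exists x, y. Qed.

Lemma derived_sub H x : is_subgroup H -> derived H x -> H x.
Proof.
move=> sgH; apply=> // _ [y [z [Hy Hz ->]]].
have [H1 HM HV] := sgH.
exact: (HM _ _ (HV _ Hy) (HM _ _ (HV _ Hz) (HM _ _ Hy Hz))).
Qed.

Lemma derived_conj H a x : is_subgroup H -> H a -> derived H x -> derived H (x ^ a).
Proof.
move=> sgH Ha Dx; have [_ DM _] := derived_subgroup H.
rewrite (_ : x ^ a = x * [~ x, a]); last by rewrite /commg /conjg !gnorm.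
exact: (DM _ _ Dx (derivedR (derived_sub sgH Dx) Ha)).
Qed.

End DerivedSubgroup.

(** * Construction of an epimorphism from [F] onto the integers *)

Section DegreeMap.
Set Implicit Arguments. Unset Strict Implicit.
Variable F : groupType.
Implicit Types (N : F -> Prop) (x y : F) (g : F -> int).

Local Notation D := (derived (@setG F)).

Let D_R x y : D [~ x, y]. Proof. exact: derivedR. Qed.

Let D_J x y : D x -> D (x ^ y).
Proof. by apply: derived_conj. Qed.

(** Additivity alone would only kill [N']; vanishing on all of [F'] makes [g] a homomorphism on the
    image of a subgroup [N] in the abelianisation of [F]. *)
Definition is_character N g :=
  (forall x y, N x -> N y -> g (x * y) = (g x + g y)%R) /\ (forall x, D x -> g x = 0%R).

Definition finite_cover N :=
  exists s : seq F, forall x, N x -> exists2 y, y \in s & D (y^-1 * x).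

(** A subgroup [N] containing [F'] is normal, so these products already form the subgroup generated
    by [N] and [x]. *)
Definition adjoin N x : F -> Prop := fun y => exists n i, N n /\ y = n * expgz x i.

Lemma character_expgz N g x i : is_subgroup N -> is_character N g -> N x ->
  g (expgz x i) = (g x * i)%R.
Proof.
move=> sgN [gD gDer] Nx.
have NX i' : N (expgz x i') by apply: subgroup_expgz.
have [D1 _ _] := derived_subgroup (@setG F).
have [_ _ NV] := sgN.
have gV : g x^-1 = (- g x)%R.
  by apply: (addrI (g x)); rewrite subrr -gD ?mulgV; [exact: gDer|done|exact: NV].
elim: i => [|n IH|n IH]; first by rewrite gDer ?mulr0.
  by rewrite -addn1 PoszD expgz_succ gD // IH mulrDr mulr1.
by rewrite -addn1 PoszD opprD expgz_pred gD ?IH ?gV ?mulrDr ?mulrN1 //; apply: NV.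
Qed.

Lemma adjoin_mulE x y i n' j :
  exists2 d, D d & y * expgz x i * (n' * expgz x j) = y * n' * d * expgz x (i + j)%R.
Proof.
exists [~ n', (expgz x i)^-1] => //.
by rewrite expgzD /commg /conjg !gnorm.
Qed.

Lemma adjoin_subgroup N x : is_subgroup N -> (forall d, D d -> N d) ->
  is_subgroup (adjoin N x).
Proof.
move=> [N1 NM NV] DN; split.
- by exists 1, 0%R; rewrite mul1g.
- move=> _ _ [n [i [Nn ->]]] [n' [j [Nn' ->]]].
  have [d Dd ->] := adjoin_mulE x n i n' j.
  by exists (n * n' * d), (i + j)%R; split=> //; apply: (NM _ _ (NM _ _ _ _)) => //; exact: DN.
move=> _ [n [i [Nn ->]]].
exists (n^-1 * [~ n^-1, expgz x i]), (- i)%R; split.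
  by apply: NM; [apply: NV | apply: DN].
by rewrite expgzN /commg /conjg !gnorm.
Qed.

(* The value [a] prescribed at [x] must agree with [m * g] on the powers of [x] lying in [N]. *)
Lemma extend_character N g x (m a : int) : is_subgroup N -> (forall d, D d -> N d) ->
  is_character N g ->
  (forall i, N (expgz x i) -> (m * g (expgz x i))%R = (a * i)%R) ->
  exists g1, [/\ is_character (adjoin N x) g1, (forall n, N n -> g1 n = (m * g n)%R)
    & g1 x = a].
Proof.
move=> sgN DN chg ga; have [gD g0] := chg; have [N1 NM NV] := sgN.
(* [R] is the graph of the extension. Two decompositions of [y] differ by a power of [x] lying in
   [N], where the prescribed values agree. *)
pose R y r := exists n i, [/\ N n, y = n * expgz x i & r = (m * g n + a * i)%R].
have Rfun y r r' : R y r -> R y r' -> r = r'.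
  move=> [n [i [Nn -> ->]]] [n' [j [Nn' e ->]]].
  have e' : n = n' * expgz x (j - i)%R.
    by rewrite expgzD mulgA -e expgzN mulgK.
  have Nx : N (expgz x (j - i)%R).
    by have := NM _ _ (NV _ Nn') Nn; rewrite e' mulKg.
  by rewrite e' gD // mulrDr ga //; ring.
pose g1 y := epsilon (inhabits 0%R) (R y).
have g1E y r : R y r -> g1 y = r.
  by move=> Ryr; apply: (Rfun y _ r) => //; apply: epsilon_spec; exists r.
have g1N n : N n -> g1 n = (m * g n)%R.
  by move=> Nn; apply: g1E; exists n, 0%R; rewrite mulg1 mulr0 addr0.
exists g1; split=> //.
  split; last by move=> y Dy; rewrite g1N ?g0 ?mulr0 //; exact: DN.
  move=> _ _ [n [i [Nn ->]]] [n' [j [Nn' ->]]].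
  have [d Dd e] := adjoin_mulE x n i n' j.
  rewrite (g1E (n * expgz x i) (m * g n + a * i)%R); last by exists n, i.
  rewrite (g1E (n' * expgz x j) (m * g n' + a * j)%R); last by exists n', j.
  apply: g1E; exists (n * n' * d), (i + j)%R; have Nd := DN _ Dd; have Nnn := NM _ _ Nn Nn'.
  by split=> //; [apply: NM | rewrite !gD // (g0 d) //; ring].
apply: g1E; exists 1, 1%R; rewrite mul1g g0 ?mulr0 ?add0r ?mulr1 //.
by case: (derived_subgroup (@setG F)).
Qed.

(** Divide the exponent of [x] by [k]: the multiple of [k] is absorbed into [N], and only the
    remainders [j < k] need new representatives. *)
Lemma finite_cover_adjoin N x (k : nat) : is_subgroup N -> (0 < k)%N -> N (x ^+ k) ->
  finite_cover N -> finite_cover (adjoin N x).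
Proof.
move=> sgN k0 Nxk [s sP].
exists [seq y * x ^+ j | y <- s, j <- iota 0 k] => _ [n [i [Nn ->]]].
have k0' : Posz k != 0%R by case: (k) k0.
have /sP [y ys Dy] : N (n * expgz (x ^+ k) (i %/ k)%Z).
  by case: (sgN) => _ NM _; apply: NM => //; apply: subgroup_expgz.
have [j jk ej] : exists2 j : nat, (j < k)%N & (i %% k)%Z = j.
  have := modz_ge0 i k0'; have := ltz_pmod i (k0 : (0 < Posz k)%R).
  by case: (i %% k)%Z => // j jk _; exists j.
exists (y * x ^+ j).
  by apply/allpairsP; exists (y, j); split=> //=; rewrite mem_iota.
have -> : expgz x i = expgz (x ^+ k) (i %/ k)%Z * x ^+ j.
  have -> : x ^+ k = expgz x k by [].
  have -> : x ^+ j = expgz x j by [].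
  by rewrite -expgzM -expgzD -ej (mulrC (Posz k)) -divz_eq.
rewrite (_ : _ * _ = (y^-1 * (n * expgz (x ^+ k) (i %/ k)%Z)) ^ (x ^+ j)); first exact: D_J.
by rewrite /conjg !gnorm.
Qed.

Lemma expgz_torsion N x i : is_subgroup N -> i != 0%R -> N (expgz x i) ->
  exists2 k : nat, (0 < k)%N & N (x ^+ k).
Proof.
move=> [_ _ NV]; case: i => [k|k] i0 Nx; first by exists k; rewrite // lt0n.
by exists k.+1 => //; rewrite -[x ^+ _]invgK; apply: NV.
Qed.

(** Starting from [F'], the elements of [s] are adjoined one by one. The quotient by [F'] stays
    finite until some [x] of infinite order modulo [N] yields a nonzero character, which then
    persists. *)
Lemma finite_cover_or_character (s : seq F) : exists N,
  [/\ is_subgroup N, forall d, D d -> N d, forall x, x \in s -> N x &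
      finite_cover N \/ exists2 g, is_character N g & exists2 x, N x & g x != 0%R].
Proof.
elim: s => [|x s [N [sgN DN sN alt]]].
  exists D; split=> //; first exact: derived_subgroup.
  by left; exists [:: 1] => x Dx; exists 1; rewrite ?inE // invg1 mul1g.
have sg1 := adjoin_subgroup x sgN DN.
have sub1 n : N n -> adjoin N x n by move=> Nn; exists n, 0%R; rewrite mulg1.
have x1 : adjoin N x x by case: sgN => N1 _ _; exists 1, 1%R; rewrite mul1g.
exists (adjoin N x); split=> //.
- by move=> d /DN /sub1.
- by move=> y; rewrite inE => /orP[/eqP -> //|/sN /sub1].
have [[k k0 Nxk]|notors] := classic (exists2 k : nat, (0 < k)%N & N (x ^+ k)).
  case: alt => [cov|[g chg [y Ny gy]]].
    by left; exact: finite_cover_adjoin Nxk cov.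
  (* [g] itself may have no integer value to take at [x], but its multiple by [k] has one, namely
     [g (x ^+ k)]. *)
  have ga i : N (expgz x i) -> (Posz k * g (expgz x i))%R = (g (x ^+ k)%g * i)%R.
    move=> Nxi; rewrite -(character_expgz i sgN chg Nxk) mulrC.
    by rewrite -(character_expgz k sgN chg Nxi) -[x ^+ k]/(expgz x k) -!expgzM mulrC.
  right; have [g1 [ch1 g1N _]] := extend_character sgN DN chg ga.
  exists g1 => //; exists y; first exact: sub1.
  by rewrite g1N // mulf_neq0 // -lt0n.
have tors i : N (expgz x i) -> i = 0%R.
  move=> Nxi; case: (eqVneq i 0%R) => // i0; case: notors.
  exact: expgz_torsion Nxi.
(* Here [x] has infinite order modulo [N], so the zero character of [N] extends with any value at
   [x]; the value 1 is taken. *)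
right; have ch0 : is_character N (fun=> 0%R) by split=> *; rewrite ?addr0.
have ga i : N (expgz x i) -> (1 * 0)%R = (1 * i)%R by move=> /tors ->.
have [g1 [ch1 _ g1x]] := extend_character sgN DN ch0 ga.
by exists g1 => //; exists x; rewrite ?g1x.
Qed.

(** Euclid's algorithm: if [g t] does not divide [g x], then [x] times a power of [t] has the
    nonzero remainder as its value, and induction on the absolute value applies. *)
Lemma character_min_value g (t : F) :
  (forall x y, g (x * y) = (g x + g y)%R) -> g t != 0%R ->
  exists2 u, g u != 0%R & forall x, (g u %| g x)%Z.
Proof.
move=> gD; have [k] := ubnP `|g t|; elim: k t => // k IH t ltk gt0.
have [dvd|/not_all_ex_not [x ndvd]] := classic (forall x, (g t %| g x)%Z).
  by exists t.
have gX n : g (expgz t n) = (g t * n)%R.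
  have g1 : g 1 = 0%R by apply: (addrI (g 1)); rewrite -gD mulg1 addr0.
  have gV y : g y^-1 = (- g y)%R by apply: (addrI (g y)); rewrite -gD mulgV subrr.
  elim: n => [|n IHn|n IHn]; first by rewrite mulr0.
    by rewrite -addn1 PoszD expgz_succ gD IHn mulrDr mulr1.
  by rewrite -addn1 PoszD opprD expgz_pred gD IHn gV mulrDr mulrN1.
have gmod : g (x * expgz t (- (g x %/ g t)%Z)%R) = (g x %% g t)%Z.
  by rewrite gD gX {1}(divz_eq (g x) (g t)); ring.
apply: (IH (x * expgz t (- (g x %/ g t)%Z)%R)); rewrite gmod.
  apply: leq_trans (ltk : (`|g t| <= k)%N).
  by have := ltz_mod (g x) gt0; rewrite -[X in (X < _)%R]gez0_abs ?modz_ge0.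
by apply/eqP => /dvdz_mod0P.
Qed.

Lemma exists_degree : finitely_generated F -> ~ finite_index D ->
  exists deg : F -> int, (forall x y, deg (x * y) = (deg x + deg y)%R) /\
    exists t, deg t = 1%R.
Proof.
move=> [s gens] infD; have [N [sgN DN sN alt]] := finite_cover_or_character s.
have NF x : N x by apply: gens.
case: alt => [[l lP]|[g [gD _] [t _ gt0]]].
  by case: infD; exists l => x; apply: lP.
have {}gD x y : g (x * y) = (g x + g y)%R by apply: gD.
have [u gu0 dvdu] := character_min_value gD gt0.
(* Division by [g u], which generates the image of [g], makes the character onto. *)
exists (fun x => (g x %/ g u)%Z); split=> [x y|]; first by rewrite gD divzDl.
by exists u; rewrite divzz gu0.
Qed.

End DegreeMap.

(** * Homomorphisms and their conjugates *)

Section Homomorphisms.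
Set Implicit Arguments. Unset Strict Implicit.
Variables F G : groupType.
Implicit Types (phi : F -> G) (x y : G) (f : F).

Lemma hom1 phi : is_hom phi -> phi 1 = 1.
Proof. by move=> hphi; apply: (mulgI (phi 1)); rewrite -hphi !mulg1. Qed.

Lemma homV phi f : is_hom phi -> phi f^-1 = (phi f)^-1.
Proof. by move=> hphi; apply: (mulgI (phi f)); rewrite -hphi !mulgV hom1. Qed.

Lemma homJ phi f g : is_hom phi -> phi (f ^ g) = phi f ^ phi g.
Proof. by move=> hphi; rewrite /conjg !hphi homV. Qed.

Lemma hom_expgz phi f n : is_hom phi -> phi (expgz f n) = expgz (phi f) n.
Proof.
move=> hphi; rewrite (expgz_unique (u := fun n => phi (expgz f n))) ?expgz1 // => i j.
by rewrite expgzD hphi.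
Qed.

Definition hconj phi x : F -> G := fun f => phi f ^ x.

Lemma hconj_hom phi x : is_hom phi -> is_hom (hconj phi x).
Proof. by move=> hphi f g; rewrite /hconj hphi conjMg. Qed.

Lemma hconjM phi x y : hconj phi (x * y) = hconj (hconj phi x) y.
Proof. by apply: functional_extensionality => f; rewrite /hconj conjgM. Qed.

Lemma hconj1 phi : hconj phi 1 = phi.
Proof. by apply: functional_extensionality => f; rewrite /hconj conjg1. Qed.

Lemma hconjK phi x : hconj (hconj phi x) x^-1 = phi.
Proof. by rewrite -hconjM mulgV hconj1. Qed.

Lemma hconjKV phi x : hconj (hconj phi x^-1) x = phi.
Proof. by rewrite -hconjM mulVg hconj1. Qed.

End Homomorphisms.

(** * Blocks of homomorphisms and their stabilisers *)

Section Divisibility.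
Set Implicit Arguments. Unset Strict Implicit.
Variables (F G : groupType) (deg : F -> int) (t : F) (H : G -> Prop).
Hypothesis degM : forall f g, deg (f * g) = (deg f + deg g)%R.
Hypothesis deg_t : deg t = 1%R.
Hypothesis sgH : is_subgroup H.
Implicit Types (phi psi chi : F -> G) (x y c d : G) (f g : F).

Definition core phi c :=
  [/\ H c, (forall f, deg f = 0%R -> commute c (phi f)) & (forall f, H (c ^ phi f))].

(* [psi] lies in the block of [phi], i.e. [psi = twist phi c] for some [c] in [core phi]. *)
Definition core_equiv phi psi :=
  (forall f, deg f = 0%R -> psi f = phi f) /\ (forall f, core phi ((phi f)^-1 * psi f)).

(* Agrees with [phi] on [ker deg] and sends [t] to [phi t * c]. *)
Definition twist phi c f := phi (f * expgz t (- deg f)%R) * expgz (phi t * c) (deg f).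

Let deg1 : deg 1 = 0%R.
Proof. by apply: (addrI (deg 1)); rewrite -degM mulg1 addr0. Qed.

Let degV f : deg f^-1 = (- deg f)%R.
Proof. by apply: (addrI (deg f)); rewrite -degM mulgV subrr. Qed.

Let deg_expt n : deg (expgz t n) = n.
Proof.
elim: n => [|n IH|n IH] //.
  by rewrite -addn1 PoszD expgz_succ degM IH deg_t.
by rewrite -addn1 PoszD opprD expgz_pred degM degV IH deg_t.
Qed.

Let degJ f g : deg (f ^ g) = deg f.
Proof. by rewrite /conjg !degM degV addrC addrK. Qed.

Lemma deg_kernel_part f : deg (f * expgz t (- deg f)%R) = 0%R.
Proof. by rewrite degM deg_expt subrr. Qed.

Lemma core_subgroup phi : is_subgroup (core phi).
Proof.
have [H1 HM HV] := sgH; split.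
- by split=> // [f _|f]; [apply/commute_sym/commute1 | rewrite conj1g].
- move=> c d [Hc Cc Jc] [Hd Cd Jd]; split=> [|f f0|f].
  + exact: HM.
  + by apply: commute_sym; apply: commuteM; apply: commute_sym; [apply: Cc|apply: Cd].
  + by rewrite conjMg; apply: HM.
move=> c [Hc Cc Jc]; split=> [|f f0|f].
- exact: HV.
- by apply: commute_sym; apply: commuteV; apply: commute_sym; apply: Cc.
- by rewrite conjVg; apply: HV.
Qed.

Lemma core_H phi c : core phi c -> H c. Proof. by case. Qed.

Lemma core_conj phi c f : is_hom phi -> core phi c -> core phi (c ^ phi f).
Proof.
move=> hphi [Hc Cc Jc]; split=> // [g g0|g]; last by rewrite -conjgM -hphi.
have e : phi g = phi (g ^ f^-1) ^ phi f by rewrite -homJ // conjgKV.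
by rewrite /commute e -!conjMg Cc // degJ.
Qed.

(** [psi f] is [phi f] times an element of [H], so conjugating by it also stays in [H]. This
    invariance along a block gives symmetry and transitivity of [core_equiv]. *)
Lemma core_equiv_core phi psi c : is_hom phi -> core_equiv phi psi -> core phi c ->
  core psi c.
Proof.
move=> hphi [e0 eC] Cc; have [Hc cc Jc] := Cc; have [H1 HM HV] := sgH.
split=> // [f f0|f]; first by rewrite e0 //; apply: cc.
rewrite -[psi f](mulVKg (phi f)) conjgM.
by have Hd := core_H (eC f); exact: (HM _ _ (HV _ Hd) (HM _ _ (Jc f) Hd)).
Qed.

Lemma core_equiv_refl phi : core_equiv phi phi.
Proof. by split=> // f; rewrite mulVg; case: (core_subgroup phi). Qed.

Lemma core_equiv_sym phi psi : is_hom phi -> core_equiv phi psi -> core_equiv psi phi.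
Proof.
move=> hphi E; have [e0 eC] := E; split=> [f /e0 //|f].
apply: (core_equiv_core hphi E); have [_ _ CV] := core_subgroup phi.
by rewrite -[phi f]invgK -invgM; apply: CV.
Qed.

Lemma core_equiv_trans phi psi chi : is_hom phi -> is_hom psi ->
  core_equiv phi psi -> core_equiv psi chi -> core_equiv phi chi.
Proof.
move=> hphi hpsi E1 [e0' eC']; have [e0 eC] := E1.
have E2 := core_equiv_sym hphi E1; split=> [f f0|f]; first by rewrite e0' ?e0.
rewrite -[chi f](mulVKg (psi f)) mulgA; have [_ CM _] := core_subgroup phi.
by apply: CM => //; apply: (core_equiv_core hpsi E2).
Qed.

Lemma core_hconj phi x c : H x -> core phi c -> core (hconj phi x) (c ^ x).
Proof.
move=> Hx [Hc cc Jc]; have [H1 HM HV] := sgH.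
have HJ y : H y -> H (y ^ x) by move=> Hy; exact: (HM _ _ (HV _ Hx) (HM _ _ Hy Hx)).
split=> [|f f0|f]; first exact: HJ.
  by rewrite /commute /hconj -!conjMg cc.
by rewrite /hconj -conjJg; apply: HJ.
Qed.

Lemma core_equiv_hconj phi psi x : H x -> core_equiv phi psi ->
  core_equiv (hconj phi x) (hconj psi x).
Proof.
move=> Hx [e0 eC]; split=> [f f0|f]; first by rewrite /hconj e0.
by rewrite /hconj -conjVg -conjMg; apply: core_hconj.
Qed.

(** By the identity [e], the quotient lies in [H] exactly when [x ^ phi f] does, and agreement on
    [ker deg] means that [x] centralises [phi (ker deg)]. *)
Lemma core_stabilizer phi x : is_hom phi -> H x ->
  core_equiv phi (hconj phi x) <-> core phi x.
Proof.
move=> hphi Hx; have [H1 HM HV] := sgH; have [C1 CM CV] := core_subgroup phi.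
have e f : (phi f)^-1 * hconj phi x f = (x^-1) ^ phi f * x.
  by rewrite /hconj /conjg !gnorm.
split=> [[e0 eC]|Cx].
  split=> // [f f0|f].
    by apply/commute_sym; rewrite /commute conjgC -[phi f ^ x]/(hconj phi x f) e0.
  rewrite -[x]invgK conjVg; apply: (HV); rewrite -[_ ^ _](mulgK x) -e.
  exact: (HM _ _ (core_H (eC f)) (HV _ Hx)).
split=> f; last by rewrite e; apply: CM => //; apply: core_conj => //; apply: CV.
by case: Cx => _ cx _ f0; rewrite /hconj /conjg -cx // mulKg.
Qed.

(** [F] is the semidirect product of [ker deg] and the powers of [t]. As [c] centralises
    [phi (ker deg)], conjugation by [phi t * c] acts there as conjugation by [phi t] does. *)
Lemma twist_hom phi c : is_hom phi -> core phi c -> is_hom (twist phi c).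
Proof.
move=> hphi [_ cc _].
have conjE f n : deg f = 0%R ->
    phi f ^ expgz (phi t * c) n = phi f ^ expgz (phi t) n.
  elim: n f => [|n IH|n IH] f f0 //.
    rewrite -addn1 PoszD !expgz_succ !conjgM IH //.
    rewrite -hom_expgz // -!homJ //; apply/conjg_fixP/commgP/commute_sym/cc.
    by rewrite !degJ.
  rewrite -addn1 PoszD opprD !expgz_pred !conjgM IH // invgM conjgM.
  rewrite -hom_expgz // -homJ //; congr (_ ^ _).
  apply/conjg_fixP/commgP; apply: commuteV; apply/commute_sym/cc.
  by rewrite degJ.
move=> f g; have ef := deg_kernel_part f; have eg := deg_kernel_part g.
set a := f * _ in ef; set b := g * _ in eg.
have -> : twist phi c f = phi a * expgz (phi t * c) (deg f) by [].
have -> : twist phi c g = phi b * expgz (phi t * c) (deg g) by [].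
rewrite -mulgA (mulgA (expgz _ _)) (conjgCV (expgz _ _) (phi b)) -expgzN conjE // expgzN.
rewrite /twist degM expgzD !mulgA; congr (_ * _ * _).
rewrite -hom_expgz // -!homV // -!hphi; congr (phi _).
by rewrite /a /b (addrC (deg f)) opprD expgzD !expgzN !gnorm.
Qed.

Lemma twist_degree0 phi c f : deg f = 0%R -> twist phi c f = phi f.
Proof. by move=> f0; rewrite /twist f0 oppr0 !expgz0 !mulg1. Qed.

Lemma twist_t phi c : is_hom phi -> twist phi c t = phi t * c.
Proof. by move=> hphi; rewrite /twist deg_t expgzN !expgz1 mulgV hom1 // mul1g. Qed.

Lemma twist_core_equiv phi c : is_hom phi -> core phi c -> core_equiv phi (twist phi c).
Proof.
move=> hphi Cc; split=> [f /twist_degree0 //|f].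
have [C1 CM CV] := core_subgroup phi.
(* Powers of [phi t] and [phi t * c] agree modulo [core phi], because [phi t] normalises it. *)
have CX n : core phi ((expgz (phi t) n)^-1 * expgz (phi t * c) n).
  elim: n => [|n IH|n IH]; first by rewrite !expgz0 invg1 mulg1.
    rewrite -addn1 PoszD !expgz_succ.
    rewrite (_ : _ * _ = ((expgz (phi t) n)^-1 * expgz (phi t * c) n) ^ phi t * c).
      by apply: CM => //; apply: core_conj.
    by rewrite /conjg !gnorm.
  rewrite -addn1 PoszD opprD !expgz_pred.
  rewrite (_ : _ * _ = ((expgz (phi t) (- n%:Z)%R)^-1 * expgz (phi t * c) (- n%:Z)%R
                          * c^-1) ^ phi t^-1).
    by apply: core_conj => //; apply: CM => //; apply: CV.
  by rewrite (homV _ hphi) /conjg !gnorm.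
by rewrite /twist hphi (hom_expgz _ _ hphi) expgzN -!mulgA mulKg.
Qed.

Lemma hom_eq_of_degree0 phi psi : is_hom phi -> is_hom psi ->
  (forall f, deg f = 0%R -> phi f = psi f) -> phi t = psi t -> phi = psi.
Proof.
move=> hphi hpsi e0 et; apply: functional_extensionality => f.
have -> : f = f * expgz t (- deg f)%R * expgz t (deg f) by rewrite expgzN mulgVK.
by rewrite hphi hpsi (e0 _ (deg_kernel_part f)) (hom_expgz _ _ hphi) (hom_expgz _ _ hpsi) et.
Qed.

(** * Orbits of blocks under conjugation by [H] *)

Definition orbit_equiv phi psi := exists2 x, H x & core_equiv (hconj phi x) psi.

Lemma orbit_equiv_sym phi psi : is_hom phi -> orbit_equiv phi psi -> orbit_equiv psi phi.
Proof.
move=> hphi [x Hx E]; have [_ _ HV] := sgH; exists x^-1; first exact: HV.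
rewrite -[phi](hconjK phi x); apply: core_equiv_hconj; first exact: HV.
by apply: core_equiv_sym => //; apply: hconj_hom.
Qed.

Lemma orbit_equiv_trans phi psi chi : is_hom phi -> is_hom psi ->
  orbit_equiv phi psi -> orbit_equiv psi chi -> orbit_equiv phi chi.
Proof.
move=> hphi hpsi [x Hx E] [y Hy E']; have [_ HM _] := sgH.
exists (x * y); first exact: HM.
rewrite hconjM; apply: core_equiv_trans E'; try by do !apply: hconj_hom.
exact: core_equiv_hconj.
Qed.

(** * Parametrising each orbit by [H] in a family closed under both operations *)

Variable Phi : (F -> G) -> Prop.
Hypothesis Phi_hom : forall phi, Phi phi -> is_hom phi.
Hypothesis Phi_hconj : forall phi x, Phi phi -> H x -> Phi (hconj phi x).
Hypothesis Phi_core_equiv : forall phi psi,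
  Phi phi -> is_hom psi -> core_equiv phi psi -> Phi psi.

Definition orbit_rep phi : F -> G :=
  epsilon (inhabits (fun=> 1)) (fun psi => Phi psi /\ orbit_equiv phi psi).

Lemma orbit_repP phi : Phi phi -> Phi (orbit_rep phi) /\ orbit_equiv phi (orbit_rep phi).
Proof.
move=> Pphi; apply: (epsilon_spec _ (fun psi => Phi psi /\ orbit_equiv phi psi)).
exists phi; split=> //; exists 1; first by case: sgH.
by rewrite hconj1; apply: core_equiv_refl.
Qed.

(** The predicates given to [epsilon] coincide by extensionality, so the choice depends only on the
    orbit. *)
Lemma orbit_rep_eq phi psi : Phi phi -> Phi psi -> orbit_equiv phi psi ->
  orbit_rep phi = orbit_rep psi.
Proof.
move=> /Phi_hom hphi /Phi_hom hpsi E; rewrite /orbit_rep; congr epsilon.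
apply: functional_extensionality => chi; apply: propositional_extensionality.
split=> -[Pchi E']; split=> //; last exact: orbit_equiv_trans E E'.
exact: orbit_equiv_trans (orbit_equiv_sym hphi E) E'.
Qed.

Definition coset_rep phi x : G :=
  epsilon (inhabits 1) (fun y => H y /\ core phi (x * y^-1)).

Lemma coset_repP phi x : H x ->
  H (coset_rep phi x) /\ core phi (x * (coset_rep phi x)^-1).
Proof.
move=> Hx; apply: (epsilon_spec _ (fun y => H y /\ core phi (x * y^-1))).
by exists x; split=> //; rewrite mulgV; case: (core_subgroup phi).
Qed.

Lemma coset_rep_eq phi x y : core phi (x * y^-1) -> coset_rep phi x = coset_rep phi y.
Proof.
move=> Cxy; have [_ CM CV] := core_subgroup phi; rewrite /coset_rep; congr epsilon.
apply: functional_extensionality => z; apply: propositional_extensionality.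
split=> -[Hz Cz]; split=> //.
  rewrite (_ : _ * _ = (x * y^-1)^-1 * (x * z^-1)); last by rewrite !gnorm.
  exact: (CM _ _ (CV _ Cxy) Cz).
rewrite (_ : _ * _ = x * y^-1 * (y * z^-1)); last by rewrite !gnorm.
exact: (CM _ _ Cxy Cz).
Qed.

(* Writing [x = c * r] with [c] in [core phi] and [r] the representative of the coset
   of [x], this is [twist phi c] conjugated by [r]. *)
Definition parametrize x phi :=
  hconj (twist phi (x * (coset_rep phi x)^-1)) (coset_rep phi x).

Lemma parametrize_orbit phi x : is_hom phi -> H x -> orbit_equiv phi (parametrize x phi).
Proof.
move=> hphi Hx; have [Hr Cr] := coset_repP phi Hx; exists (coset_rep phi x) => //.
by apply: core_equiv_hconj => //; apply: twist_core_equiv.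
Qed.

Lemma parametrize_in phi x : Phi phi -> H x -> Phi (parametrize x phi).
Proof.
move=> Pphi Hx; have [Hr Cr] := coset_repP phi Hx; have hphi := Phi_hom Pphi.
apply: Phi_hconj => //; apply: (Phi_core_equiv Pphi); first exact: twist_hom.
exact: twist_core_equiv.
Qed.

(** If [y] carries the block of [phi] to that of [psi], so does its coset representative [r].
    Undoing [r] gives a homomorphism in the block of [phi], and [c] is read off at [t]. *)
Lemma parametrize_surj phi psi : is_hom phi -> is_hom psi -> orbit_equiv phi psi ->
  exists2 x, H x & parametrize x phi = psi.
Proof.
move=> hphi hpsi [y Hy E]; have [H1 HM HV] := sgH.
have [Hr Cr] := coset_repP phi Hy; set r := coset_rep phi y in Hr Cr.
have [C1 CM CV] := core_subgroup phi.
have E' : core_equiv phi (hconj psi r^-1).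
  apply: (core_equiv_trans (psi := hconj phi (y * r^-1))) => //; first exact: hconj_hom.
    by apply/core_stabilizer => //; apply: core_H Cr.
  by rewrite hconjM; apply: core_equiv_hconj => //; apply: HV.
have h' : is_hom (hconj psi r^-1) by apply: hconj_hom.
pose c := (phi t)^-1 * hconj psi r^-1 t.
have Cc : core phi c by exact: (E'.2 t).
have er : coset_rep phi (c * r) = r.
  apply: coset_rep_eq; rewrite (_ : c * r * y^-1 = c * (y * r^-1)^-1).
    exact: (CM _ _ Cc (CV _ Cr)).
  by rewrite invgM invgK mulgA.
exists (c * r); first by apply: HM => //; apply: core_H Cc.
rewrite /parametrize er mulgK -[RHS](hconjKV psi r); congr hconj.
apply: hom_eq_of_degree0 => //; first exact: twist_hom.
  by case: E' => e0 _ f f0; rewrite twist_degree0 // e0.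
by rewrite twist_t // mulVKg.
Qed.

(** Equal values force [s * r^-1] to stabilise the block of [phi], so [x] and [y] lie in one coset
    of the core; evaluation at [t] then separates them. *)
Lemma parametrize_inj phi x y : is_hom phi -> H x -> H y ->
  parametrize x phi = parametrize y phi -> x = y.
Proof.
move=> hphi Hx Hy; rewrite /parametrize; have [H1 HM HV] := sgH.
have [Hr Cr] := coset_repP phi Hx; have [Hs Cs] := coset_repP phi Hy.
set r := coset_rep phi x in Hr Cr *; set s := coset_rep phi y in Hs Cs * => e.
have [C1 CM CV] := core_subgroup phi.
have e1 : twist phi (x * r^-1) = hconj (twist phi (y * s^-1)) (s * r^-1).
  by rewrite hconjM -e hconjK.
have Hsr : H (s * r^-1) by apply: HM => //; apply: HV.
have Csr : core phi (s * r^-1).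
  apply/core_stabilizer => //.
  apply: (core_equiv_trans (psi := twist phi (x * r^-1))) => //.
  - exact: twist_hom.
  - exact: twist_core_equiv.
  rewrite e1; apply: core_equiv_hconj => //; apply: core_equiv_sym => //.
  exact: twist_core_equiv.
have ers : r = s.
  rewrite /r /s; apply: coset_rep_eq.
  rewrite (_ : _ * _ = (x * r^-1) * (s * r^-1)^-1 * (y * s^-1)^-1); last by rewrite !gnorm.
  by apply: (CM _ _ (CM _ _ _ _)) => //; apply: CV.
move: e1; rewrite -ers mulgV hconj1 => /(congr1 (fun psi => psi t)).
by rewrite !twist_t // => /mulgI /mulIg.
Qed.

(** The cofactor is the set of chosen representatives, one for each orbit of blocks. *)
Theorem card_dvd_hom_family : card_dvd H Phi.
Proof.
exists {phi | Phi phi /\ orbit_rep phi = phi}, (fun x m => parametrize x (sval m)).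
split=> [x [phi [Pphi rphi]] Hx|psi Ppsi|x x' [phi [Pphi rphi]] [psi [Ppsi rpsi]] Hx Hx' /= e].
- exact: parametrize_in.
- have [Pphi E] := orbit_repP Ppsi; have hpsi := Phi_hom Ppsi; have hphi := Phi_hom Pphi.
  have rr : orbit_rep (orbit_rep psi) = orbit_rep psi by rewrite -(orbit_rep_eq Ppsi Pphi E).
  have [x Hx ex] := parametrize_surj hphi hpsi (orbit_equiv_sym hpsi E).
  by exists x, (exist (fun phi => Phi phi /\ orbit_rep phi = phi) _ (conj Pphi rr)).
have hpsi := Phi_hom Ppsi; have hphi := Phi_hom Pphi.
have ephi : phi = psi.
  rewrite -rphi -rpsi (orbit_rep_eq Pphi (parametrize_in Pphi Hx)); last exact: parametrize_orbit.
  rewrite (orbit_rep_eq Ppsi (parametrize_in Ppsi Hx')) ?e //; exact: parametrize_orbit.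
subst psi; split; first exact: parametrize_inj e.
by congr exist; apply: proof_irrelevance.
Qed.

End Divisibility.

(** * Closure of the homomorphisms with [phi(W) = A] under both operations *)

Theorem mainTheorem6 (G F : groupType) (A : G -> Prop) (W : F -> Prop) :
  is_subgroup A -> is_subgroup W ->
  finitely_generated F ->
  ~ finite_index (derived (@setG F)) ->
  card_dvd (derived A) (fun phi : F -> G => is_hom phi /\ image_is phi W A).
Proof.
move=> sgA sgW fgF infF; have [deg [degM [t degt]]] := exists_degree fgF infF.
have [A1 AM AV] := sgA; have [W1 WM WV] := sgW.
apply: (card_dvd_hom_family degM degt (derived_subgroup A)).
- by move=> phi [].
- move=> phi x [hphi imphi] /(derived_sub sgA) Ax; split; first exact: hconj_hom.
  have AJ a y : A a -> A y -> A (a ^ y).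
    by move=> Aa Ay; exact: (AM _ _ (AV _ Ay) (AM _ _ Aa Ay)).
  have [w0 Ww0 ew0] := (imphi x).1 Ax.
  move=> a; split=> [Aa|[w Ww <-]]; last by apply: AJ => //; apply/imphi; exists w.
  have /imphi [w Ww ew] : A (a ^ x^-1) by apply: AJ => //; apply: AV.
  by exists w => //; rewrite /hconj ew conjgKV.
move=> phi psi [hphi imphi] hpsi [e0 eC]; split=> // a.
have deg1 : deg 1 = 0%R by apply: (addrI (deg 1)); rewrite -degM mulg1 addr0.
have degV f : deg f^-1 = (- deg f)%R by apply: (addrI (deg f)); rewrite -degM mulgV subrr.
(* [A'] is already the image of [W'], on which the degree vanishes. *)
have lift c : derived A c -> exists w, [/\ W w, deg w = 0%R & phi w = c].
  move=> /(_ (fun c => exists w, [/\ W w, deg w = 0%R & phi w = c])).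
  apply.
    split.
    - by exists 1; split=> //; apply: hom1.
    - move=> _ _ [v [Wv v0 <-]] [w [Ww w0 <-]]; exists (v * w).
      by split; [exact: WM | rewrite degM v0 w0 | exact: hphi].
    - move=> _ [v [Wv v0 <-]]; exists v^-1.
      by split; [exact: WV | rewrite degV v0 oppr0 | exact: homV].
  move=> _ [_ [_ [/imphi [v Wv <-] /imphi [w Ww <-] ->]]]; exists [~ v, w]; split.
  - exact: (WM _ _ (WV _ Wv) (WM _ _ (WV _ Ww) (WM _ _ Wv Ww))).
  - by rewrite /commg /conjg !degM !degV; ring.
  - by rewrite /commg hphi homJ // homV.
split=> [/imphi [w Ww <-]|[w Ww <-]].
  (* Since [v] has degree 0, [psi v = phi v]; hence [psi] sends [w * v^-1] to [phi w]. *)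
  have [v [Wv v0 ev]] := lift _ (core_H (eC w)).
  exists (w * v^-1); first by apply: WM => //; apply: WV.
  by rewrite hpsi homV // (e0 v v0) ev invgM invgK mulgA mulgV mul1g.
rewrite -[psi w](mulVKg (phi w)); apply: AM; first by apply/imphi; exists w.
by apply: derived_sub (core_H (eC w)).
Qed.
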